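(* Let $p\ge 3$ be an odd integer. There exists a constant $c_0=c_0(p)>0$, depending only on $p$, such that the following holds for every positive integer $n$. Let $\widehat{\mathcal T}:=\mathcal T+\mathcal E\in\bigotimes^p\mathbb R^n$, where $\mathcal T=\sum_{i=1}^n\lambda_i\,\boldsymbol v_i^{\otimes p}$ with $\{\boldsymbol v_1,\dots,\boldsymbol v_n\}$ an orthonormal basis of $\mathbb R^n$ and $\lambda_i>0$ for all $i\in[n]$, and $\mathcal E$ is a symmetric tensor with operator norm $\varepsilon:=\|\mathcal E\|$. Assume $\varepsilon\le c_0\,\lambda_{\min}/n^{1/(p-1)}$, where $\lambda_{\min}:=\min_{i\in[n]}\lambda_i$. Let $\{(\hat\lambda_i,\hat{\boldsymbol v}_i)\}_{i\in[n]}$ be any output of the Successive Rank-One Approximation algorithm on input $\widehat{\mathcal T}$. Then there exists a permutation $\pi$ of $[n]$ such that for all $j\in[n]$, $$|\lambda_{\pi(j)}-\hat\lambda_j|\le 2\varepsilon\qquad\text{and}\qquad \|\boldsymbol v_{\pi(j)}-\hat{\boldsymbol v}_j\|\le \frac{20\,\varepsilon}{\lambda_{\pi(j)}}.$$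
   Context: Notation: $[n]:=\{1,\dots,n\}$. $\bigotimes^p\mathbb R^n:=\mathbb R^{n\times\cdots\times n}$ ($p$ factors) is the space of real $p$-th order $n$-dimensional tensors. A tensor $\mathcal A=(\mathcal A_{i_1,\dots,i_p})$ is symmetric if its entries are invariant under every permutation of their indices. For $\boldsymbol v\in\mathbb R^n$, $\boldsymbol v^{\otimes p}$ is the tensor with entries $(\boldsymbol v^{\otimes p})_{i_1,\dots,i_p}=v_{i_1}\cdots v_{i_p}$. For vectors $\boldsymbol x_1,\dots,\boldsymbol x_p\in\mathbb R^n$, $\mathcal A(\boldsymbol x_1,\dots,\boldsymbol x_p):=\sum_{i_1,\dots,i_p\in[n]}\mathcal A_{i_1,\dots,i_p}(\boldsymbol x_1)_{i_1}\cdots(\boldsymbol x_p)_{i_p}$, and $\mathcal A\boldsymbol x^{\otimes p}:=\mathcal A(\boldsymbol x,\dots,\boldsymbol x)$. The operator norm is $\|\mathcal A\|:=\max_{\|\boldsymbol x_1\|=\cdots=\|\boldsymbol x_p\|=1}\mathcal A(\boldsymbol x_1,\dots,\boldsymbol x_p)$. On vectors, $\|\cdot\|$ is the Euclidean norm. Successive Rank-One Approximation (SROA) algorithm, for odd $p$: given a symmetric tensor $\widehat{\mathcal T}\in\bigotimes^p\mathbb R^n$, set $\widehat{\mathcal T}_0:=\widehat{\mathcal T}$. For $i=1,\dots,n$: choose (arbitrarily among maximizers) $\hat{\boldsymbol v}_i\in\arg\max_{\|\boldsymbol v\|=1}\widehat{\mathcal T}_{i-1}\boldsymbol v^{\otimes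 p}$, set $\hat\lambda_i:=\widehat{\mathcal T}_{i-1}\hat{\boldsymbol v}_i^{\otimes p}$, and set $\widehat{\mathcal T}_i:=\widehat{\mathcal T}_{i-1}-\hat\lambda_i\hat{\boldsymbol v}_i^{\otimes p}$. The output is $\{(\hat\lambda_i,\hat{\boldsymbol v}_i)\}_{i\in[n]}$. (For odd $p$ this is the paper's form of choosing $(\hat\lambda_i,\hat{\boldsymbol v}_i)$ to minimize the Frobenius norm $\|\widehat{\mathcal T}_{i-1}-\lambda\boldsymbol v^{\otimes p}\|_F$ over $\lambda\in\mathbb R$, $\|\boldsymbol v\|=1$, with the sign convention $\hat\lambda_i\ge0$.) *)

(* Defs.v *)
From HB Require Import structures.
From mathcomp Require Import all_boot all_order all_algebra all_fingroup.
From mathcomp Require Import all_classical all_reals all_analysis.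

Set Implicit Arguments.
Unset Strict Implicit.
Unset Printing Implicit Defensive.

Import Order.TTheory GRing.Theory Num.Theory.
Local Open Scope classical_set_scope.
Local Open Scope ring_scope.

(* A multi-index (i_1, ..., i_p) is a finite function from 'I_p to 'I_n.  The
   codomain is R^o, not R, to obtain the canonical lmodType structure. *)
Notation tensor R p n := {ffun {ffun 'I_p -> 'I_n} -> R^o}.

Section Tensors.
Context {R : realType}.

Definition dot n (u v : 'rV[R]_n) : R := \sum_(i < n) u 0 i * v 0 i.

(* The canonical norm `|v| on 'rV[R]_n is the sup norm, not this one. *)
Definition enorm n (v : 'rV[R]_n) : R := Num.sqrt (dot v v).

(* n orthonormal vectors of R^n automatically span. *)
Definition orthonormal_basis n (v : 'I_n -> 'rV[R]_n) : Prop :=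
  forall i j, dot (v i) (v j) = (i == j)%:R.

Definition symmetric_tensor p n (A : tensor R p n) : Prop :=
  forall (s : {perm 'I_p}) (i : {ffun 'I_p -> 'I_n}),
    A [ffun k => i (s k)] = A i.

Definition tpow p n (v : 'rV[R]_n) : tensor R p n :=
  [ffun i : {ffun 'I_p -> 'I_n} => \prod_(k < p) v 0 (i k)].

Definition teval p n (A : tensor R p n) (x : 'I_p -> 'rV[R]_n) : R :=
  \sum_(i : {ffun 'I_p -> 'I_n}) A i * \prod_(k < p) x k 0 (i k).

Definition tform p n (A : tensor R p n) (x : 'rV[R]_n) : R :=
  teval A (fun=> x).

(* For n > 0 the supremum is a maximum: teval A is continuous and the unit
   sphere of R^n is compact and nonempty. *)
Definition opnorm p n (A : tensor R p n) : R :=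
  sup [set teval A x | x in [set x | forall k, enorm (x k) = 1]].

Definition sphere_argmax n (f : 'rV[R]_n -> R) (v : 'rV[R]_n) : Prop :=
  enorm v = 1 /\ forall u, enorm u = 1 -> f u <= f v.

Definition min_of n (n_gt0 : (0 < n)%N) (l : 'I_n -> R) : R :=
  \big[Num.min/l (Ordinal n_gt0)]_(i < n) l i.

(* With 'I_n numbered from 0, U i is the residual tensor from which the pair
   (lh i, vh i) is extracted; the values of U beyond n are irrelevant. *)
Definition SROA_output p n (That : tensor R p n)
    (lh : 'I_n -> R) (vh : 'I_n -> 'rV[R]_n) : Prop :=
  exists U : nat -> tensor R p n,
    U 0%N = That /\
    forall i : 'I_n,
      [/\ sphere_argmax (tform (U i)) (vh i),
          lh i = tform (U i) (vh i) &
          U i.+1 = U i - lh i *: tpow p (vh i)].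

End Tensors.

(* Main.v *)
Require Import Defs.
From HB Require Import structures.
From mathcomp Require Import all_boot all_order all_algebra all_fingroup.
From mathcomp Require Import all_classical all_reals all_analysis ring lra.
Import Order.TTheory GRing.Theory Num.Theory.
Local Open Scope ring_scope.

Set Implicit Arguments.
Unset Strict Implicit.
Unset Printing Implicit Defensive.

(** The theorem follows by induction on the extraction steps: as long as every
pair extracted so far approximates its own component [lam l, v l], the next
maximizer approximates one of the remaining components, with the same
constants.  The difficulty is that each deflation leaves behind the tensor
[lam l *: tpow p (v l) - mu l *: tpow p (w l)], of size comparable to the
noise [eps], and that up to [n] of them add up.

Two facts keep the accumulated deflation error under control; both are in
[deflation_error_le].  In the direction of a unit vector [x] the [l]-th error
is at most a constant times [eps * (|<v l, x>| + 20 * eps / lam l) ^ (p - 1)].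
Since [p - 1 >= 2], the powers of the coordinates [<v l, x>] sum to at most
[1], and the bound on [eps], with its factor [n ^ (-1 / (p - 1))], makes the
powers of the [eps / lam l] sum to a small constant: the total is [O(eps)]
whatever the number of steps.  Moreover, at a point [x] almost orthogonal to
the extracted components, the total is only a small fraction of [eps], and
this is what prevents the constants from deteriorating along the induction.

Let [x] maximize the residual form.  Its value is compared with the values at
the remaining [v l]; with the [O(eps)] bound this forces some coordinate
[a = <v k, x>] of a remaining component to be close to [1] ([dominant_index]).
Hence [x] is almost orthogonal to all the extracted components, and the
deflation error at [x] drops below [3/10 * eps].  Values alone would locate
[x] within the square root of [eps / lam k] only; the linear rate comes from
the first-order optimality condition [tdir_argmax] in the tangent direction
that points to [v k].  There the component [k] contributes
[lam k * a ^ (p - 1) * r], where [r] is the sine of the angle between [x] and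
[v k], the other remaining components contribute [O(lam k * r ^ 2)], and the
noise and the deflation error contribute [O(eps)]; so [r = O(eps / lam k)]
([radius_le]).  Substituting this in the value of the form at [x] gives the
bound on the eigenvalue ([spike_recovered]). *)


(** * Euclidean geometry *)

Section InnerProduct.
Context {R : realType} {n : nat}.
Implicit Types (x y z u : 'rV[R]_n) (v : 'I_n -> 'rV[R]_n) (a : R).

Lemma dotC x y : dot x y = dot y x.
Proof. by apply: eq_bigr => i _; rewrite mulrC. Qed.

Lemma dotDl x y z : dot (x + y) z = dot x z + dot y z.
Proof. by rewrite /dot -big_split; apply: eq_bigr => i _; rewrite mxE mulrDl. Qed.

Lemma dotZl a x z : dot (a *: x) z = a * dot x z.
Proof. by rewrite /dot mulr_sumr; apply: eq_bigr => i _; rewrite mxE mulrA. Qed.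

Lemma dotDr x y z : dot z (x + y) = dot z x + dot z y.
Proof. by rewrite dotC dotDl !(dotC z). Qed.

Lemma dotZr a x z : dot z (a *: x) = a * dot z x.
Proof. by rewrite dotC dotZl (dotC z). Qed.

Lemma dotNl x z : dot (- x) z = - dot x z.
Proof. by rewrite -scaleN1r dotZl mulN1r. Qed.

Lemma dotNr x z : dot z (- x) = - dot z x.
Proof. by rewrite dotC dotNl (dotC z). Qed.

Lemma dotBl x y z : dot (x - y) z = dot x z - dot y z.
Proof. by rewrite dotDl dotNl. Qed.

Definition dotE := (dotDl, dotDr, dotNl, dotNr, dotZl, dotZr).

Lemma dot_ge0 x : 0 <= dot x x.
Proof. by apply: sumr_ge0 => i _; rewrite -expr2 sqr_ge0. Qed.

Lemma sqr_enorm x : enorm x ^+ 2 = dot x x.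
Proof. by rewrite sqr_sqrtr ?dot_ge0. Qed.

Lemma enorm1P x : enorm x = 1 <-> dot x x = 1.
Proof.
by split=> h; rewrite -?sqr_enorm ?h ?expr1n // /enorm h sqrtr1.
Qed.

Lemma enorm_le x a : 0 <= a -> dot x x <= a ^+ 2 -> enorm x <= a.
Proof. by move=> a0 h; rewrite -(ger0_norm a0) -sqrtr_sqr ler_wsqrtr. Qed.

Lemma enormZ a x : enorm (a *: x) = `|a| * enorm x.
Proof. by rewrite /enorm !dotE mulrA -expr2 sqrtrM ?sqr_ge0 // sqrtr_sqr. Qed.

Lemma enormN x : enorm (- x) = enorm x.
Proof. by rewrite -scaleN1r enormZ normrN1 mul1r. Qed.

(** Cauchy-Schwarz, from the positivity of the squared norm of the component of
[y] orthogonal to [x]. *)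
Lemma dot_unit_le x y : enorm x = 1 -> `|dot y x| <= enorm y.
Proof.
move=> /enorm1P x1; rewrite -sqrtr_sqr ler_wsqrtr //.
have := dot_ge0 (y - dot y x *: x).
by rewrite !dotE x1 (dotC x y); set a := dot y x => ?; nra.
Qed.

(** Parseval: the matrix with rows [v i] has its transpose as right inverse, hence
also as left inverse. *)
Lemma dot_orthonormal_sum v x : orthonormal_basis v ->
  \sum_i dot (v i) x ^+ 2 = dot x x.
Proof.
move=> hv; pose V := \matrix_(i, j) v i 0 j.
have VVT : V *m V^T = 1%:M.
  apply/matrixP => i j; rewrite !mxE -hv; apply: eq_bigr => k _.
  by rewrite !mxE.
have VTV := mulmx1C VVT.
have dE y : dot y y = (y *m y^T) 0 0.
  by rewrite mxE; apply: eq_bigr => k _; rewrite mxE.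
have -> : \sum_i dot (v i) x ^+ 2 = dot (x *m V^T) (x *m V^T).
  apply: eq_bigr => i _; rewrite expr2.
  suff -> : dot (v i) x = (x *m V^T) 0 i by [].
  by rewrite mxE dotC; apply: eq_bigr => k _; rewrite !mxE.
by rewrite !dE trmx_mul trmxK mulmxA -(mulmxA x) VTV mulmx1.
Qed.

Lemma coord_unit_le x i : enorm x = 1 -> `|x 0 i| <= 1.
Proof.
move=> /enorm1P x1; rewrite -(@ler_pXn2r _ 2) ?nnegrE // real_normK ?num_real //.
rewrite expr1n -x1 /dot (bigD1 i) //= -expr2 lerDl.
by apply: sumr_ge0 => j _; rewrite -expr2 sqr_ge0.
Qed.

End InnerProduct.

(** * Multilinear forms of tensors *)

Section Forms.
Context {R : realType} {p n : nat}.
Implicit Types (A B : tensor R p n) (x u w : 'rV[R]_n) (X : 'I_p -> 'rV[R]_n).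

Lemma tevalD A B X : teval (A + B) X = teval A X + teval B X.
Proof. by rewrite /teval -big_split; apply: eq_bigr => i _; rewrite ffunE mulrDl. Qed.

Lemma tevalZ (c : R) A X : teval (c *: A) X = c * teval A X.
Proof. by rewrite /teval mulr_sumr; apply: eq_bigr => i _; rewrite ffunE -mulrA. Qed.

Lemma tevalN A X : teval (- A) X = - teval A X.
Proof. by rewrite -scaleN1r tevalZ mulN1r. Qed.

Lemma teval_sum (I : finType) (P : pred I) (F : I -> tensor R p n) X :
  teval (\sum_(i | P i) F i) X = \sum_(i | P i) teval (F i) X.
Proof.
apply: (big_morph (fun A => teval A X)) => [A B|]; first exact: tevalD.
by rewrite -(scale0r (0 : tensor R p n)) tevalZ mul0r.
Qed.

Lemma teval_tpow w X : teval (tpow p w) X = \prod_k dot w (X k).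
Proof.
rewrite /dot bigA_distr_bigA; apply: eq_bigr => i _.
by rewrite ffunE big_split.
Qed.

Lemma tform_tpow w x : tform (tpow p w) x = dot w x ^+ p.
Proof. by rewrite /tform teval_tpow prodr_const card_ord. Qed.

Lemma teval_le_sum A X : (forall k, enorm (X k) = 1) ->
  teval A X <= \sum_i `|A i|.
Proof.
move=> X1; apply: ler_sum => i _; apply: le_trans (ler_norm _) _.
rewrite normrM ler_piMr // normr_prod prodr_ile1 // => k _.
by rewrite normr_ge0 coord_unit_le.
Qed.

Lemma teval_le_opnorm A X : (forall k, enorm (X k) = 1) ->
  teval A X <= opnorm A.
Proof.
move=> X1; apply: ub_le_sup; last by exists X.
by exists (\sum_i `|A i|) => _ [Y Y1 <-]; exact: teval_le_sum.
Qed.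

(** Flipping one argument turns the one-sided bound given by the supremum into a
bound on the absolute value. *)
Lemma teval_opp_at A X k0 :
  teval A (fun k => if k == k0 then - X k else X k) = - teval A X.
Proof.
rewrite /teval -sumrN; apply: eq_bigr => i _.
rewrite -mulrN; congr (_ * _); rewrite (bigD1 k0) //= eqxx mxE.
rewrite (bigD1 k0 (P := xpredT) (F := fun k => X k 0 (i k))) //= mulNr.
by congr (- (_ * _)); apply: eq_bigr => k /negbTE ->.
Qed.

Lemma norm_teval_le A X : (0 < p)%N -> (forall k, enorm (X k) = 1) ->
  `|teval A X| <= opnorm A.
Proof.
move=> p0 X1; rewrite ler_norml teval_le_opnorm // andbT lerNl.
rewrite -(teval_opp_at A X (Ordinal p0)); apply: teval_le_opnorm => k.
by case: ifP => _; rewrite ?enormN.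
Qed.

Lemma opnorm_ge0 A : (0 < p)%N -> (0 < n)%N -> 0 <= opnorm A.
Proof.
move=> p0 n0; pose e : 'rV[R]_n := delta_mx 0 (Ordinal n0).
apply: le_trans (norm_teval_le (X := fun=> e) A p0 _) => // _.
apply/enorm1P; rewrite /dot (bigD1 (Ordinal n0)) //= !mxE !eqxx mulr1 big1 ?addr0 //.
by move=> i /negbTE i0; rewrite mxE i0 andbF mul0r.
Qed.

(** The derivative of [tform A] at [x] in the direction [u]. *)
Definition tdir A x u : R :=
  \sum_k teval A (fun l => if l == k then u else x).

Lemma tdirD A B x u : tdir (A + B) x u = tdir A x u + tdir B x u.
Proof. by rewrite /tdir -big_split; apply: eq_bigr => k _; rewrite tevalD. Qed.

Lemma tdirZ (c : R) A x u : tdir (c *: A) x u = c * tdir A x u.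
Proof. by rewrite /tdir mulr_sumr; apply: eq_bigr => k _; rewrite tevalZ. Qed.

Lemma tdirN A x u : tdir (- A) x u = - tdir A x u.
Proof. by rewrite -scaleN1r tdirZ mulN1r. Qed.

Lemma tdir_sum (I : finType) (P : pred I) (F : I -> tensor R p n) x u :
  tdir (\sum_(i | P i) F i) x u = \sum_(i | P i) tdir (F i) x u.
Proof.
rewrite /tdir [RHS]exchange_big; apply: eq_bigr => k _.
by rewrite teval_sum.
Qed.

Lemma tdir_tpow w x u :
  tdir (tpow p w) x u = p%:R * (dot w x ^+ p.-1 * dot w u).
Proof.
rewrite /tdir (eq_bigr (fun=> dot w x ^+ p.-1 * dot w u)) => [|k _].
  by rewrite sumr_const card_ord mulr_natl.
rewrite teval_tpow (bigD1 k) //= eqxx mulrC; congr (_ * _).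
rewrite (eq_bigr (fun=> dot w x)) => [|l /negbTE -> //].
by rewrite prodr_const cardC1 card_ord.
Qed.

Lemma norm_tdir_le A x u : enorm x = 1 -> enorm u = 1 ->
  `|tdir A x u| <= p%:R * opnorm A.
Proof.
move=> x1 u1; rewrite mulr_natl -[X in _ *+ X]card_ord -sumr_const.
apply: le_trans (ler_norm_sum _ _ _) _; apply: ler_sum => k _.
apply: norm_teval_le => [|l]; last by case: ifP.
exact: leq_ltn_trans (ltn_ord k).
Qed.

End Forms.

(** * First-order optimality on the sphere *)

Section Stationarity.
Context {R : realType}.

Lemma deriv_prod (I : finType) (F : I -> {poly R}) :
  (\prod_i F i)^`() = \sum_i (F i)^`() * \prod_(j | j != i) F j.
Proof.
have : uniq (index_enum I) by exact: index_enum_uniq.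
elim: (index_enum I) => [|i r IH]; first by rewrite !big_nil derivC.
move=> /= /andP[ir ur]; rewrite !big_cons eqxx /= derivM IH //; congr (_ + _).
  congr (_ * _); rewrite [RHS]big_seq_cond [LHS]big_seq.
  apply: eq_bigl => j; case jr : (j \in r) => //=.
  by apply/esym; apply: contraNneq ir => <-.
rewrite mulr_sumr [RHS]big_seq [LHS]big_seq; apply: eq_bigr => j jr.
rewrite big_cons (_ : i != j) 1?mulrCA //.
by apply: contraNneq ir => ->.
Qed.

Lemma poly_max_deriv0 (q : {poly R}) :
  (forall t, q.[t] <= q.[0]) -> q^`().[0] = 0.
Proof.
move=> qmax.
have [_ <-] := is_derive_poly q 0.
have [] // := @derive1_at_max R (horner q) (-1) 1 0.
by rewrite in_itv /=; lra.
Qed.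

(** By homogeneity, maximality at [x] bounds [tform A] on the tangent line:
[tform A (x + t *: u) <= tform A x * Num.sqrt (1 + t ^+ 2) ^+ p].  Dropping the
square root, harmless as the value at [x] is nonnegative, makes the difference
of the two sides a polynomial in [t] that is maximal at [0]. *)
Lemma tdir_argmax p n (A : tensor R p n) (x u : 'rV[R]_n) :
  sphere_argmax (tform A) x -> 0 <= tform A x -> enorm u = 1 -> dot x u = 0 ->
  tdir A x u = 0.
Proof.
move=> [/enorm1P x1 xmax] fx0 /enorm1P u1 xu0.
pose line (i : {ffun 'I_p -> 'I_n}) : {poly R} :=
  \prod_k ((x 0 (i k))%:P + (u 0 (i k)) *: 'X).
pose q : {poly R} := \sum_i (A i : R) *: line i - tform A x *: (1 + 'X^2) ^+ p.
have qE t : q.[t] = tform A (x + t *: u) - tform A x * (1 + t ^+ 2) ^+ p.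
  rewrite /q !hornerE horner_sum; congr (_ - _).
  apply: eq_bigr => i _; rewrite hornerZ horner_prod; congr (_ * _).
  by apply: eq_bigr => k _; rewrite !hornerE !mxE (mulrC t).
have q0 : q.[0] = 0 by rewrite qE scale0r addr0 expr0n /= addr0 expr1n mulr1 subrr.
have := @poly_max_deriv0 q; rewrite q0.
have -> : q^`().[0] = tdir A x u.
  rewrite /q derivB derivZ deriv_exp !poly.derivE /= !hornerE raddf_sum /= horner_sum.
  rewrite hornerMn hornerM hornerD hornerX addr0 mul0r mul0rn mulr0 subr0.
  rewrite /tdir [RHS]exchange_big /=; apply: eq_bigr => i _.
  rewrite derivZ hornerZ deriv_prod horner_sum -mulr_sumr; congr (_ * _).
  apply: eq_bigr => k _; rewrite !poly.derivE !hornerE horner_prod.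
  rewrite (bigD1 k (P := xpredT)) //= eqxx ?(add0r, mulr1, addr0).
  congr (_ * _); apply: eq_bigr => l /negbTE ->.
  by rewrite !hornerE ?(mulr0, mul0r, addr0).
apply=> t; rewrite qE subr_le0.
pose c := Num.sqrt (1 + t ^+ 2).
have t2 : 0 <= t ^+ 2 by exact: sqr_ge0.
have c1 : 1 <= c by rewrite -{1}sqrtr1 ler_wsqrtr //; lra.
have c2 : c ^+ 2 = 1 + t ^+ 2 by rewrite sqr_sqrtr //; lra.
have cV : c != 0 by apply/eqP; lra.
have -> : tform A (x + t *: u) = c ^+ p * tform A (c^-1 *: (x + t *: u)).
  rewrite /tform /teval mulr_sumr; apply: eq_bigr => i _.
  rewrite mulrCA; congr (_ * _).
  rewrite -[X in c ^+ X]card_ord -prodr_const -big_split; apply: eq_bigr => k _.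
  by rewrite /= [in RHS]mxE mulVKf.
rewrite mulrC; apply: (@le_trans _ _ (tform A x * c ^+ p)).
  rewrite ler_wpM2r ?exprn_ge0 //; first lra.
  apply: xmax; apply/enorm1P; rewrite !dotE x1 u1 (dotC u) xu0.
  transitivity (c^-1 * (c^-1 * c ^+ 2)); first by rewrite c2; ring.
  by rewrite expr2 mulKf ?mulVf.
rewrite ler_wpM2l // -c2 lerXn2r ?nnegrE ?sqr_ge0 //; first lra.
by rewrite expr2 ler_pMr //; lra.
Qed.

End Stationarity.

(** * Power inequalities *)

Section PowerInequalities.
Context {R : realFieldType}.
Implicit Types (a b y z tau : R) (q : nat).

Lemma le_factor (b M t : R) : 0 < b -> 0 <= t -> t <= 1 -> b <= M * t -> b <= M.
Proof. by case: (leP 0 M) => *; nra. Qed.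

Lemma norm_subrXX_le a b (Y : R) q : `|a| <= Y -> `|b| <= Y ->
  `|a ^+ q - b ^+ q| <= q%:R * `|a - b| * Y ^+ q.-1.
Proof.
move=> aY bY; have Y0 : 0 <= Y by apply: le_trans aY.
rewrite subrXX normrM (mulrC q%:R) -mulrA ler_wpM2l //.
apply: le_trans (ler_norm_sum _ _ _) _.
rewrite mulr_natl -[X in _ *+ X]card_ord -sumr_const; apply: ler_sum => i _.
have -> : Y ^+ q.-1 = Y ^+ (q.-1 - i) * Y ^+ i.
  by rewrite -exprD subnK // -ltnS (ltn_predK (ltn_ord i)).
by rewrite normrM !normrX ler_pM ?exprn_ge0 // lerXn2r ?nnegrE.
Qed.

Lemma exprD_le_max a b q : 0 <= a -> 0 <= b ->
  (a + b) ^+ q <= 2 ^+ q * (a ^+ q + b ^+ q).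
Proof.
move=> a0 b0; wlog ab : a b a0 b0 / a <= b => [H|].
  by case: (leP a b) => [|/ltW] ?; [exact: H | rewrite addrC (addrC (a ^+ q)) H].
apply: (@le_trans _ _ ((2 * b) ^+ q)).
  by rewrite lerXn2r ?nnegrE; lra.
by rewrite exprMn ler_wpM2l ?exprn_ge0 // lerDr exprn_ge0.
Qed.

(** A form of Young's inequality: according to which of [tau * z] and [y] is
larger, one of the two terms on the right suffices.  The small coefficient
[tau] of [z ^+ 2] is what makes the gradient error a small fraction of the
noise. *)
Lemma pow_mul_le y z tau q : (1 < q)%N -> 0 <= y -> 0 <= z -> z <= 1 ->
  0 < tau -> tau <= 1 -> y ^+ q.-1 * z <= y ^+ q / tau + tau * z ^+ 2.
Proof.
case: q => [|[|q]] //= _ y0 z0 z1 t0 t1.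
have yq0 k : 0 <= y ^+ k by rewrite exprn_ge0.
case: (leP (tau * z) y) => [zy|yz].
  apply: (@le_trans _ _ (y ^+ q.+2 / tau)).
    by rewrite ler_pdivlMr // -mulrA [leRHS]exprSr ler_wpM2l // mulrC.
  by rewrite lerDl mulr_ge0 ?sqr_ge0 // ltW.
apply: (@le_trans _ _ (tau * z ^+ 2)).
  rewrite expr2 mulrA ler_wpM2r //; apply: le_trans (ltW yz).
  by rewrite exprS ler_piMr // exprn_ile1 //; nra.
by rewrite lerDr divr_ge0 // ltW.
Qed.

(** The contribution of one extracted component to the derivative of the deflation
error: [a], [b] are the coordinates of the point on the exact and on the
computed vector, and [y], [z] those of the direction.  The difference is split
by replacing [a] with [b], then [lam] with [mu], then [y] with [z]. *)
Lemma perturbed_term_le q (lam mu eps dl a b y z tau : R) :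
  (1 < q)%N -> 0 < lam -> 0 <= dl -> dl <= 2^-1 -> lam * dl = eps ->
  `|lam - mu| <= 2 * eps -> `|a - b| <= 20 * dl -> `|y - z| <= 20 * dl ->
  `|y| <= 1 -> 0 < tau -> tau <= 1 ->
  `|lam * a ^+ q * y - mu * b ^+ q * z| <=
    eps * ((20 * q%:R / tau + 42) * (`|a| + 20 * dl) ^+ q
           + 20 * q%:R * tau * y ^+ 2).
Proof.
move=> q1 lam0 dl0 dl2 epsE hlam hab hyz hy t0 t1.
set Y := `|a| + 20 * dl.
have aY : `|a| <= Y by rewrite lerDl; lra.
have bY : `|b| <= Y.
  have := ler_normB a (a - b); rewrite opprB addrC subrK => h.
  by rewrite /Y; lra.
have Y0 : 0 <= Y by apply: le_trans aY.
have Yq0 k : 0 <= Y ^+ k by rewrite exprn_ge0.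
have bq : `|b ^+ q| <= Y ^+ q by rewrite normrX lerXn2r ?nnegrE.
have eps0 : 0 <= eps by rewrite -epsE mulr_ge0 // ltW.
have mu2 : `|mu| <= 2 * lam.
  have := ler_normB lam (lam - mu); rewrite opprB addrC subrK (gtr0_norm lam0).
  by nra.
have -> : lam * a ^+ q * y - mu * b ^+ q * z =
  lam * ((a ^+ q - b ^+ q) * y) + (lam - mu) * (b ^+ q * y) + mu * (b ^+ q * (y - z)).
  by ring.
have h1 : `|lam * ((a ^+ q - b ^+ q) * y)| <=
    eps * (20 * q%:R * (Y ^+ q / tau + tau * y ^+ 2)).
  rewrite -epsE normrM (gtr0_norm lam0) -!mulrA ler_wpM2l ?(ltW lam0) // normrM.
  have := pow_mul_le q1 Y0 (normr_ge0 y) hy t0 t1.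
  rewrite real_normK ?num_real // => h.
  apply: (@le_trans _ _ (q%:R * (20 * dl) * Y ^+ q.-1 * `|y|)).
    rewrite ler_wpM2r //; apply: le_trans (norm_subrXX_le _ aY bY) _.
    by rewrite ler_wpM2r // ler_wpM2l.
  have -> : q%:R * (20 * dl) * Y ^+ q.-1 * `|y| =
     20 * q%:R * dl * (Y ^+ q.-1 * `|y|) by ring.
  have -> : dl * (20 * (q%:R * (Y ^+ q / tau + tau * y ^+ 2))) =
     20 * q%:R * dl * (Y ^+ q / tau + tau * y ^+ 2) by ring.
  by rewrite ler_wpM2l // mulr_ge0 // mulr_ge0.
have h2 : `|(lam - mu) * (b ^+ q * y)| <= eps * (2 * Y ^+ q).
  rewrite normrM mulrA (mulrC eps) ler_pM // normrM.
  by rewrite -[leRHS]mulr1 ler_pM.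
have h3 : `|mu * (b ^+ q * (y - z))| <= eps * (40 * Y ^+ q).
  rewrite -epsE normrM.
  have -> : lam * dl * (40 * Y ^+ q) = (2 * lam) * (Y ^+ q * (20 * dl)) by ring.
  by rewrite ler_pM // normrM ler_pM.
have -> : eps * ((20 * q%:R / tau + 42) * Y ^+ q + 20 * q%:R * tau * y ^+ 2) =
  eps * (20 * q%:R * (Y ^+ q / tau + tau * y ^+ 2)) + eps * (2 * Y ^+ q)
  + eps * (40 * Y ^+ q) by ring.
by apply: le_trans (ler_normD _ _) _; rewrite lerD // (le_trans (ler_normD _ _)) // lerD.
Qed.

End PowerInequalities.

(** * The accumulated deflation error *)

Section DeflationError.
Context {R : realType} {n : nat}.

(** Up to the factor [q.+1], the derivative at [x] in the direction [u] of
[\sum_(l in S) (lam l * <v l, x> ^ q.+1 - mu l * <w l, x> ^ q.+1)]; by Euler's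
identity, for [u = x] it is the value of that form, so that a single estimate
controls values and derivatives. *)
Definition deflation_error (q : nat) (S : {set 'I_n}) (lam mu : 'I_n -> R)
    (v w : 'I_n -> 'rV[R]_n) (x u : 'rV[R]_n) : R :=
  \sum_(l in S) (lam l * dot (v l) x ^+ q * dot (v l) u
                 - mu l * dot (w l) x ^+ q * dot (w l) u).

Definition deflation_const (q : nat) : R := 5000 * q%:R ^+ 2 * 2 ^+ q.

Lemma deflation_const_ge0 q : 0 <= deflation_const q.
Proof. by rewrite /deflation_const !mulr_ge0 ?sqr_ge0 ?exprn_ge0 ?ler0n. Qed.

(** The choice makes [20 * noise_const q], [(K + 3) * noise_const q] and
[K * (K + 3) * noise_const q] small, for [K = deflation_const q]. *)
Definition noise_const (q : nat) : R := (1000 * (deflation_const q + 3) ^+ 2)^-1.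

Lemma noise_constE q : 1000 * (deflation_const q + 3) ^+ 2 * noise_const q = 1.
Proof.
have K0 := deflation_const_ge0 q; rewrite /noise_const.
move: (deflation_const q) K0 => K K0; apply: mulfV; apply: lt0r_neq0.
by apply: mulr_gt0; [lra | apply: exprn_gt0; lra].
Qed.

Lemma noise_const_gt0 q : 0 < noise_const q.
Proof.
have K0 := deflation_const_ge0 q; rewrite /noise_const.
move: (deflation_const q) K0 => K K0; rewrite invr_gt0.
by apply: mulr_gt0; [lra | apply: exprn_gt0; lra].
Qed.

Lemma noise_const_le q : 20 * noise_const q <= 1.
Proof.
have := noise_constE q; have := noise_const_gt0 q; have := deflation_const_ge0 q.
by move: (deflation_const q) (noise_const q) => K c *; nra.
Qed.

(** Summing [perturbed_term_le] over [S], the powers of the coordinates of [x] are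
at most their squares, and the squares of the coordinates of [u] sum to at
most [1]. *)
Lemma deflation_error_le q (S : {set 'I_n}) (lam mu : 'I_n -> R)
    (v w : 'I_n -> 'rV[R]_n) (eps beta : R) (x u : 'rV[R]_n) :
  (1 < q)%N -> orthonormal_basis v -> 0 <= eps -> (forall l, 0 < lam l) ->
  (forall l, eps / lam l <= 2^-1) ->
  \sum_l (20 * (eps / lam l)) ^+ q <= beta ->
  (forall l, l \in S -> `|lam l - mu l| <= 2 * eps
                     /\ enorm (v l - w l) <= 20 * (eps / lam l)) ->
  enorm x = 1 -> enorm u = 1 ->
  `|deflation_error q S lam mu v w x u| <=
     eps * (1/10 + deflation_const q * (\sum_(l in S) dot (v l) x ^+ 2 + beta)).
Proof.
move=> q1 hv eps0 lam0 dl2 hbeta hS x1 u1.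
have q0 : 0 < q%:R :> R by rewrite ltr0n ltnW.
have q1' : 1 <= q%:R :> R by rewrite ler1n ltnW.
(* This makes the coefficient [20 * q * tau] of the squares equal to 1/10. *)
pose tau : R := (200 * q%:R)^-1.
have t0 : 0 < tau by rewrite invr_gt0 mulr_gt0.
have t1 : tau <= 1 by rewrite invf_le1; nra.
have v1 l : enorm (v l) = 1 by apply/enorm1P; rewrite hv eqxx.
have dl0 l : 0 <= eps / lam l by rewrite divr_ge0 // ltW.
have ax l y : enorm y = 1 -> `|dot (v l) y| <= 1.
  by move=> y1; rewrite -(v1 l) dot_unit_le.
pose Y l := `|dot (v l) x| + 20 * (eps / lam l).
have Yq l : Y l ^+ q <= 2 ^+ q * (dot (v l) x ^+ 2 + (20 * (eps / lam l)) ^+ q).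
  apply: le_trans (exprD_le_max _ _ _) _ => //; first by rewrite mulr_ge0.
  rewrite ler_wpM2l ?exprn_ge0 // lerD2r -[leRHS]real_normK ?num_real //.
  exact: (ler_wiXn2l (normr_ge0 _) (ax _ _ x1)).
have step : `|deflation_error q S lam mu v w x u| <=
   \sum_(l in S) eps * (5000 * q%:R ^+ 2 * Y l ^+ q + 1/10 * dot (v l) u ^+ 2).
  apply: le_trans (ler_norm_sum _ _ _) _; apply: ler_sum => l lS.
  have [hl hw] := hS l lS.
  apply: le_trans (@perturbed_term_le _ _ _ _ eps (eps / lam l) _ _ _ _ tau _ _ _ _ _ _ _ _ _ _ _) _ => //.
  - by rewrite mulrC divfK // gt_eqF.
  - by apply: le_trans hw; rewrite -dotBl dot_unit_le.
  - by apply: le_trans hw; rewrite -dotBl dot_unit_le.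
  - exact: ax.
  rewrite ler_wpM2l // lerD //; last first.
    by rewrite ler_wpM2r ?sqr_ge0 // /tau le_eqVlt; apply/orP; left; apply/eqP; field; lra.
  rewrite ler_wpM2r ?exprn_ge0 ?addr_ge0 ?(mulr_ge0 _ (dl0 l)) //.
  by rewrite /tau invrK; nra.
apply: le_trans step _; rewrite -mulr_sumr ler_wpM2l // big_split -!mulr_sumr /=.
have yS : \sum_(l in S) dot (v l) u ^+ 2 <= 1.
  move/enorm1P: u1 => <-; rewrite -(dot_orthonormal_sum _ hv).
  by rewrite [leRHS](bigID (mem S)) /= lerDl sumr_ge0 // => l _; rewrite sqr_ge0.
rewrite addrC lerD //; first lra.
rewrite /deflation_const -[leRHS]mulrA.
apply: ler_wpM2l; first exact: mulr_ge0 (ler0n _ _) (sqr_ge0 _).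
apply: le_trans; first by apply: ler_sum => l _; exact: Yq.
rewrite -mulr_sumr ler_wpM2l ?exprn_ge0 // big_split /= lerD2l.
apply: le_trans hbeta; rewrite [leRHS](bigID (mem S)) /= lerDl.
by apply: sumr_ge0 => l _; rewrite exprn_ge0 // mulr_ge0.
Qed.

End DeflationError.

(** * Coordinates of a unit vector *)

Section UnitCoordinates.
Context {R : realType} {n : nat}.
Implicit Types (a lam : 'I_n -> R) (P : pred 'I_n) (k : 'I_n) (eps t r : R).

Lemma sum_sqr_pred_le1 a P : \sum_l a l ^+ 2 = 1 ->
  0 <= \sum_(l | P l) a l ^+ 2 <= 1.
Proof.
move=> <-; rewrite [X in _ <= _ <= X](bigID P) /= lerDl.
by rewrite !sumr_ge0 // => l _; rewrite sqr_ge0.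
Qed.

(** Take [k] maximizing [lam l * a l ^+ (p - 2)] over [P], and let [M] be the
maximum.  Splitting [a l ^+ p] as [a l ^+ (p - 2) * a l ^+ 2] bounds the sum by
[M], because the squares sum to at most [1]; so [M] is at least every
[lam l - C * eps].  As [p - 2] is odd, [a k ^+ (p - 2)] being positive makes
[a k] positive. *)
Lemma dominant_index a lam p P l0 (C eps t : R) : (2 < p)%N -> odd p ->
  \sum_l a l ^+ 2 = 1 -> (forall l, `|a l| <= 1) -> (forall l, 0 < lam l) ->
  0 <= eps -> t < 1/2 -> P l0 -> (forall l, C * eps <= lam l * t) ->
  (forall l, P l -> lam l - C * eps <= \sum_(l | P l) lam l * a l ^+ p) ->
  exists2 k, P k &
    [/\ 0 < a k, 1 - t <= a k ^+ (p - 2) & forall l, P l -> lam l <= 2 * lam k].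
Proof.
move=> p_ge3 p_odd suma a1 lam_gt0 eps0 t2 Pl0 Ct hV.
have [k Pk hk] := @arg_maxP _ _ _ l0 P (fun l => lam l * a l ^+ (p - 2)) Pl0.
set M := lam k * a k ^+ (p - 2) in hk.
have {}hk l : P l -> lam l * a l ^+ (p - 2) <= M by exact: hk.
have sum_le : \sum_(l | P l) lam l * a l ^+ p <= M * \sum_(l | P l) a l ^+ 2.
  rewrite mulr_sumr; apply: ler_sum => l Pl.
  by rewrite -{1}[p](@subnK 2) ?(ltnW p_ge3) // exprD mulrA ler_wpM2r ?sqr_ge0 // hk.
have /andP[T0 T1] := sum_sqr_pred_le1 P suma.
have le_M l : P l -> lam l - C * eps <= M.
  move=> Pl; apply: (le_factor _ T0 T1); last exact: le_trans (hV l Pl) sum_le.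
  rewrite subr_gt0; apply: le_lt_trans (Ct l) _.
  by rewrite gtr_pMr //; lra.
have lamk := lam_gt0 k.
have akp : 1 - t <= a k ^+ (p - 2).
  rewrite -(ler_pM2l lamk) mulrBr mulr1; apply: le_trans (le_M k Pk).
  by rewrite lerD2l lerN2.
have ak_gt0 : 0 < a k.
  rewrite -(@exprn_odd_gt0 _ (p - 2)); last by rewrite oddB ?(ltnW p_ge3) // p_odd.
  by move: akp t2; lra.
exists k => //; split=> // l Pl.
have M_le : M <= lam k.
  by rewrite /M ler_piMr ?(ltW lamk) // exprn_ile1 ?(ltW ak_gt0) // (le_trans (ler_norm _)).
have := le_M l Pl; have := Ct l; have : lam l * t <= lam l * (1/2).
  by apply: ler_wpM2l; exact: ltW.
by move: M_le; lra.
Qed.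

Lemma sum_sqr_off a k r : \sum_l a l ^+ 2 = 1 -> r ^+ 2 = 1 - a k ^+ 2 ->
  \sum_(l | l != k) a l ^+ 2 = r ^+ 2.
Proof. by move=> + ->; rewrite (bigD1 k) //= => <-; rewrite addrAC subrr add0r. Qed.

Lemma sum_sqr_off_le a k r P : ~~ P k -> \sum_(l | l != k) a l ^+ 2 = r ^+ 2 ->
  \sum_(l | P l) a l ^+ 2 <= r ^+ 2.
Proof.
move=> Pk <-; rewrite [leRHS](bigID P) /=.
rewrite [X in _ <= X + _](_ : _ = \sum_(l | P l) a l ^+ 2); last first.
  apply: eq_bigl => l; case Pl : (P l); rewrite ?andbF ?andbT //.
  by apply: contraNneq Pk => <-.
by rewrite lerDl sumr_ge0 // => l _; rewrite sqr_ge0.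
Qed.

(** Away from [k] all coordinates are at most [r] in absolute value and their
squares sum to [r ^+ 2]; since [p >= 3], their powers are cubically small. *)
Lemma off_power_sum_le a lam P k p r (L : R) : (2 < p)%N -> 0 <= r -> 0 <= L ->
  (forall l, `|a l| <= 1) -> \sum_(l | l != k) a l ^+ 2 = r ^+ 2 ->
  (forall l, 0 < lam l) -> (forall l, P l -> lam l <= L) ->
  \sum_(l | P l && (l != k)) lam l * `|a l| ^+ p <= L * r ^+ 3.
Proof.
move=> p_ge3 r0 L0 a1 sumr lam_gt0 lamL.
have a_le_r l : l != k -> `|a l| <= r.
  move=> lk; rewrite -(@ler_pXn2r _ 2) ?nnegrE // real_normK ?num_real // -sumr.
  by rewrite (bigD1 l) //= lerDl sumr_ge0 // => i _; rewrite sqr_ge0.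
apply: (@le_trans _ _ (\sum_(l | P l && (l != k)) L * r * a l ^+ 2)).
  apply: ler_sum => l /andP[Pl lk].
  apply: (@le_trans _ _ (lam l * (r * a l ^+ 2))).
    apply: ler_wpM2l; first exact: ltW.
    apply: (@le_trans _ _ (`|a l| ^+ 3)); first exact: ler_wiXn2l.
    rewrite exprS real_normK ?num_real // ler_wpM2r ?sqr_ge0 //; exact: a_le_r.
  rewrite mulrA; apply: ler_wpM2r; first exact: sqr_ge0.
  by apply: ler_wpM2r => //; exact: lamL.
rewrite -mulr_sumr [leRHS](_ : _ = L * r * r ^+ 2); last by ring.
apply: ler_wpM2l; first exact: mulr_ge0.
apply: (@sum_sqr_off_le _ k) => //; first by rewrite eqxx andbF.
Qed.

End UnitCoordinates.

(** * Maximizers of a residual form *)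

Section ResidualMaximizer.
Context {R : realType} {p n : nat}.
Variables (lam mu : 'I_n -> R) (v w : 'I_n -> 'rV[R]_n) (E : tensor R p n).
Variable S : {set 'I_n}.

Let eps := opnorm E.
Let dl l := eps / lam l.
Let K : R := deflation_const p.-1.
Let c0 : R := noise_const p.-1.
Let err := deflation_error p.-1 S lam mu v w.

Definition residual : tensor R p n :=
  \sum_l lam l *: tpow p (v l) + E - \sum_(l in S) mu l *: tpow p (w l).

Hypothesis p_ge3 : (2 < p)%N.
Hypothesis p_odd : odd p.
Hypothesis v_onb : orthonormal_basis v.
Hypothesis lam_gt0 : forall l, 0 < lam l.
Hypothesis dl_le : forall l, dl l <= c0.
Hypothesis sum_dl_le : \sum_l (20 * dl l) ^+ p.-1 <= 20 * c0.
Hypothesis extracted : forall l, l \in S ->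
  `|lam l - mu l| <= 2 * eps /\ enorm (v l - w l) <= 20 * dl l.

Let predpK : p.-1.+1 = p. Proof. by rewrite prednK // (leq_trans _ p_ge3). Qed.

Lemma tform_residual y : tform residual y =
  \sum_(l | l \notin S) lam l * dot (v l) y ^+ p + tform E y + err y y.
Proof.
rewrite /tform /residual !tevalD tevalN !teval_sum.
under eq_bigr do rewrite tevalZ [teval _ _]tform_tpow.
under [X in _ - X]eq_bigr do rewrite tevalZ [teval _ _]tform_tpow.
rewrite (bigID (mem S)) /= /err /deflation_error sumrB.
under [X in _ = _ + (X - _)]eq_bigr do rewrite -mulrA -exprSr predpK.
under [X in _ = _ + (_ - X)]eq_bigr do rewrite -mulrA -exprSr predpK.
ring.
Qed.

Lemma tdir_residual x u : tdir residual x u =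
  p%:R * (\sum_(l | l \notin S) lam l * (dot (v l) x ^+ p.-1 * dot (v l) u)
          + err x u) + tdir E x u.
Proof.
rewrite /residual !tdirD tdirN !tdir_sum.
under eq_bigr do rewrite tdirZ tdir_tpow mulrCA.
under [X in _ - X]eq_bigr do rewrite tdirZ tdir_tpow mulrCA.
rewrite -!mulr_sumr (bigID (mem S)) /= /err /deflation_error sumrB.
under [X in _ = _ * (_ + (X - _)) + _]eq_bigr do rewrite -mulrA.
under [X in _ = _ * (_ + (_ - X)) + _]eq_bigr do rewrite -mulrA.
ring.
Qed.

Let v1 l : enorm (v l) = 1. Proof. by apply/enorm1P; rewrite v_onb eqxx. Qed.

Let K_ge0 : 0 <= K.
Proof. exact: deflation_const_ge0. Qed.

Let c0E : 1000 * (K + 3) ^+ 2 * c0 = 1.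
Proof. exact: noise_constE. Qed.

Let c0_gt0 : 0 < c0.
Proof. exact: noise_const_gt0. Qed.

Let K1c0_le : (K + 3) * c0 <= 1 / 3000.
Proof. by move: K_ge0 c0E c0_gt0; move: K c0 => k c *; nra. Qed.

Let KK1c0_le : K * ((K + 3) * c0) <= 1 / 1000.
Proof. by move: K_ge0 c0E c0_gt0; move: K c0 => k c *; nra. Qed.

Let eps_ge0 (l : 'I_n) : 0 <= eps.
Proof.
by apply: opnorm_ge0; [exact: leq_trans p_ge3 | exact: leq_ltn_trans (ltn_ord l)].
Qed.

Let dl_ge0 l : 0 <= dl l.
Proof. by apply: divr_ge0; [exact: eps_ge0 l | exact: ltW]. Qed.

Let lam_dl l : lam l * dl l = eps.
Proof. by rewrite mulrC divfK // gt_eqF. Qed.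

Let C_eps_le l : (K + 3) * eps <= lam l * ((K + 3) * c0).
Proof.
rewrite -(lam_dl l) mulrCA; apply: ler_wpM2l; first exact: ltW.
by apply: ler_wpM2l (dl_le l); exact: addr_ge0.
Qed.

Let tform_E_le y : enorm y = 1 -> `|tform E y| <= eps.
Proof. by move=> y1; apply: norm_teval_le => //; exact: leq_trans p_ge3. Qed.

Let Kc0_le : K * c0 <= 1 / 1000.
Proof. by move: K_ge0 KK1c0_le c0_gt0; move: K c0 => k c *; nra. Qed.

(** The coarse bound: whatever [y], it is [O(eps)], and it improves as [y] gets
orthogonal to the extracted components. *)
Let err_le y u : enorm y = 1 -> enorm u = 1 ->
  `|err y u| <= eps * (1/5 + K * \sum_(l in S) dot (v l) y ^+ 2).
Proof.
move=> y1 u1.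
have [l0 _|/eq_card0 n0] := pickP (fun _ : 'I_n => true); last first.
  by move: y1; rewrite /enorm /dot big1 ?sqrtr0 => [/esym/eqP|i]; rewrite ?oner_eq0 //;
     have := ltn_ord i; rewrite -[X in (_ < X)%N]card_ord n0.
apply: le_trans (deflation_error_le (beta := 20 * c0) _ v_onb (eps_ge0 l0) lam_gt0
  _ sum_dl_le extracted y1 u1) _; first by rewrite -ltnS predpK.
  by move=> l; apply: le_trans (dl_le l) _; move: K1c0_le c0_gt0 K_ge0;
     move: K c0 => k c *; nra.
apply: (ler_wpM2l (eps_ge0 l0)); rewrite -/K mulrDr.
by move: Kc0_le; lra.
Qed.

(** At [v m] the coordinates along the extracted components vanish, so the
deflation error is a small fraction of [eps]. *)
Lemma tform_residual_spike m : m \notin S ->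
  lam m - 6/5 * eps <= tform residual (v m).
Proof.
move=> mS; rewrite tform_residual (bigD1 m) //=.
rewrite v_onb eqxx expr1n mulr1 big1 => [|l /andP[_ /negbTE lm]]; last first.
  by rewrite v_onb lm expr0n -predpK mulr0.
have := err_le (v1 m) (v1 m); rewrite big1 => [|l lS]; last first.
  by rewrite v_onb (_ : (l == m) = false) ?expr0n //; apply: contraNF mS => /eqP <-.
rewrite mulr0 addr0 => /ler_normlP[+ _]; have /ler_normlP[+ _] := tform_E_le (v1 m).
by lra.
Qed.

(** The value at [x] beats the values at all the remaining [v m], and the coarse
bound on the deflation error suffices to single out a component. *)
Let dominant x m0 : m0 \notin S -> sphere_argmax (tform residual) x ->
  exists2 k, k \notin S &
    [/\ 0 < dot (v k) x, 1 - (K + 3) * c0 <= dot (v k) x ^+ (p - 2)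
      & forall l, l \notin S -> lam l <= 2 * lam k].
Proof.
move=> m0S [x1 fmax]; have eps0 := eps_ge0 m0.
have suma : \sum_l dot (v l) x ^+ 2 = 1.
  by rewrite dot_orthonormal_sum //; exact/enorm1P.
apply: (@dominant_index _ _ _ lam p _ m0 (K + 3) eps _) => //.
- by move=> l; rewrite -(v1 l) dot_unit_le.
- by move: K1c0_le; lra.
move=> m mS; have := le_trans (tform_residual_spike mS) (fmax _ (v1 m)).
rewrite tform_residual.
have /ler_normlP[_ +] := err_le x1 x1; have /ler_normlP[_ +] := tform_E_le x1.
have /andP[_ /(ler_wpM2l K_ge0)] := sum_sqr_pred_le1 (mem S) suma.
move/(ler_wpM2l eps0); rewrite /=.
by lra.
Qed.

Section AtDominant.
Variables (x : 'rV[R]_n) (k : 'I_n).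
Hypothesis kS : k \notin S.
Hypothesis xmax : sphere_argmax (tform residual) x.
Let a l := dot (v l) x.
Hypothesis ak_gt0 : 0 < a k.
Hypothesis akp : 1 - (K + 3) * c0 <= a k ^+ (p - 2).
Hypothesis lam_k : forall l, l \notin S -> lam l <= 2 * lam k.

Let r := Num.sqrt (1 - a k ^+ 2).

Let x1 : enorm x = 1. Proof. by case: xmax. Qed.
Let xx : dot x x = 1. Proof. exact/enorm1P. Qed.
Let a_le1 l : `|a l| <= 1. Proof. by rewrite -(v1 l) dot_unit_le. Qed.
Let ak_le1 : a k <= 1. Proof. exact: le_trans (ler_norm _) (a_le1 k). Qed.

Let akp_le : a k ^+ (p - 2) <= a k.
Proof. by rewrite -[leRHS]expr1; apply: ler_wiXn2l; rewrite ?(ltW ak_gt0) ?subn_gt0. Qed.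

Let r_ge0 : 0 <= r. Proof. exact: sqrtr_ge0. Qed.

Let r2E : r ^+ 2 = 1 - a k ^+ 2.
Proof. by rewrite sqr_sqrtr // subr_ge0 exprn_ile1 // ltW. Qed.

Let r2_le : r ^+ 2 <= 2 * ((K + 3) * c0).
Proof. by rewrite r2E; have := sqr_ge0 (1 - a k); move: akp akp_le; lra. Qed.

Let r_le : r <= 1 / 10.
Proof. by rewrite -(@ler_pXn2r _ 2) ?nnegrE //; move: r2_le K1c0_le; lra. Qed.

Let sum_off : \sum_(l | l != k) a l ^+ 2 = r ^+ 2.
Proof. by apply: sum_sqr_off r2E; rewrite dot_orthonormal_sum. Qed.

(** Being close to [v k], the point [x] is almost orthogonal to the extracted
components. *)
Let err_small u : enorm u = 1 -> `|err x u| <= 3/10 * eps.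
Proof.
move=> u1; apply: le_trans (err_le x1 u1) _; rewrite mulrC; apply: ler_wpM2r.
  exact: eps_ge0 k.
have := ler_wpM2l K_ge0 (le_trans (sum_sqr_off_le kS sum_off) r2_le).
by move: KK1c0_le; lra.
Qed.

Let off_le : \sum_(l | (l \notin S) && (l != k)) lam l * `|a l| ^+ p
  <= 2 * lam k * r ^+ 3.
Proof. by apply: off_power_sum_le => //; rewrite mulr_ge0 // ltW. Qed.

(** Stationarity in the tangent direction [u] from [x] towards [v k].  The
coordinate of [u] along [v k] is [r], and along another [v l] it is
[- (a k * a l) / r], so that [off_le] bounds the other remaining components by
[2 * lam k * r ^+ 2]; with [r <= 1/10] this is absorbed by the main term. *)
Lemma radius_le : lam k * r <= 2 * eps.
Proof.
have [->|r_neq0] := eqVneq r 0.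
  by rewrite mulr0 mulr_ge0 // (eps_ge0 k).
have r_gt0 : 0 < r by rewrite lt_neqAle eq_sym r_neq0.
pose u := r^-1 *: (v k - a k *: x).
have vx l : dot (v l) x = a l by [].
have u1 : enorm u = 1.
  apply/enorm1P; rewrite !dotE v_onb eqxx xx (dotC x) vx.
  transitivity (r^-1 * (r^-1 * r ^+ 2)); first by rewrite r2E /=; ring.
  by rewrite expr2 mulKf ?mulVf.
have xu : dot x u = 0 by rewrite !dotE xx (dotC x) vx; ring.
have Fx0 : 0 <= tform residual x.
  apply: le_trans (le_trans (tform_residual_spike kS) (proj2 xmax _ (v1 k))).
  have := C_eps_le k; have := ler_wpM2l (ltW (lam_gt0 k)) K1c0_le.
  by have := mulr_ge0 K_ge0 (eps_ge0 k); move: (lam_gt0 k); lra.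
have := tdir_argmax xmax Fx0 u1 xu; rewrite tdir_residual.
have vu l : dot (v l) u = r^-1 * ((l == k)%:R - a k * a l).
  by rewrite !dotE v_onb vx; ring.
rewrite (bigD1 k) //= vu eqxx vx.
have -> : r^-1 * (1%:R - a k * a k) = r.
  by transitivity (r^-1 * r ^+ 2); [rewrite r2E; ring | rewrite expr2 mulKf].
set rest := \sum_(l | _) _.
have hrest : `|rest| <= 2 * lam k * r ^+ 2.
  apply: (@le_trans _ _ (r^-1 * (2 * lam k * r ^+ 3))); last first.
    by rewrite exprS mulrCA mulKf.
  apply: le_trans (ler_norm_sum _ _ _) _.
  apply: (@le_trans _ _ (r^-1 * \sum_(l | (l \notin S) && (l != k)) lam l * `|a l| ^+ p)).
    rewrite mulr_sumr; apply: ler_sum => l /andP[lS /negbTE lk].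
    rewrite vu lk sub0r vx -{2}predpK exprSr.
    have -> : lam l * (a l ^+ p.-1 * (r^-1 * - (a k * a l))) =
       - (a k * (r^-1 * (lam l * (a l ^+ p.-1 * a l)))) by ring.
    rewrite normrN normrM (gtr0_norm ak_gt0) -[leRHS]mul1r ler_pM //; first exact: ltW.
    by rewrite !normrM normfV (gtr0_norm r_gt0) (gtr0_norm (lam_gt0 l)) normrX.
  by rewrite ler_wpM2l // invr_ge0.
have akq : 99/100 <= a k ^+ p.-1.
  have -> : p.-1 = (p - 2).+1 by rewrite -subn1 -subSn ?(ltnW p_ge3).
  rewrite exprSr.
  have t1 : 0 <= 1 - (K + 3) * c0 by move: K1c0_le; lra.
  apply: le_trans (ler_pM t1 t1 akp (le_trans akp akp_le)).
  by have := sqr_ge0 ((K + 3) * c0); move: K1c0_le; lra.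
have p_gt0 : 0 < p%:R :> R by rewrite ltr0n (leq_trans _ p_ge3).
have := norm_tdir_le E x1 u1; rewrite -/eps => /ler_normlP[hE _] hst.
have {hst hE} hX : lam k * (a k ^+ p.-1 * r) + rest + err x u <= eps.
  rewrite -(ler_pM2l p_gt0); apply: le_trans hE.
  by move/eqP: hst; rewrite addr_eq0 => /eqP ->.
have /ler_normlP[hR _] := err_small u1.
move/ler_normlP: hrest => [hrest _].
have lam0 := ltW (lam_gt0 k).
have lr : lam k * (99/100 * r) <= lam k * (a k ^+ p.-1 * r).
  by apply: (ler_wpM2l lam0); exact: ler_wpM2r.
have lr2 : lam k * r ^+ 2 <= lam k * (1/10 * r).
  by apply: (ler_wpM2l lam0); rewrite expr2; exact: ler_wpM2r.
have lr0 := mulr_ge0 lam0 r_ge0.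
by move: lr lr2 lr0 hrest hR hX; lra.
Qed.

(** The distance satisfies [enorm (v k - x) ^+ 2 = 2 * (1 - a k) <= 2 * r ^+ 2].
The eigenvalue is bounded below by comparing with the value at [v k], and above
because the remaining components other than [k] contribute only
[O(lam k * r ^+ 3)]. *)
Lemma spike_recovered :
  `|lam k - tform residual x| <= 2 * eps /\ enorm (v k - x) <= 20 * dl k.
Proof.
have lam0 := ltW (lam_gt0 k); have eps0 := eps_ge0 k.
have r_dl : r <= 2 * dl k.
  by rewrite -(ler_pM2l (lam_gt0 k)) mulrCA lam_dl; exact: radius_le.
split; last first.
  apply: enorm_le; first by rewrite mulr_ge0.
  rewrite !dotE v_onb eqxx xx (dotC x) -/(a k) /=.
  have r2_dl : r ^+ 2 <= (2 * dl k) ^+ 2.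
    by apply: lerXn2r => //; rewrite nnegrE mulr_ge0.
  have ak2 : a k ^+ 2 <= a k by rewrite expr2 ler_piMr // ltW.
  by move: r2_dl ak2 (sqr_ge0 (dl k)); rewrite r2E; lra.
rewrite ler_distlC; apply/andP; split.
  have := proj2 xmax _ (v1 k); have := tform_residual_spike kS.
  by move: eps0; lra.
rewrite tform_residual (bigD1 k) //= -/(a k).
set rest := \sum_(l | _) _.
have hrest : rest <= 2 * lam k * r ^+ 3.
  apply: le_trans off_le; apply: ler_sum => l _; apply: ler_wpM2l; first exact: ltW.
  by rewrite -normrX ler_norm.
have hk1 : lam k * a k ^+ p <= lam k.
  by rewrite ler_piMr ?exprn_ile1 // ltW.
have hr3 : lam k * r ^+ 3 <= 1/50 * eps.
  rewrite exprS mulrA; apply: (@le_trans _ _ (2 * eps * (1/100))).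
    apply: ler_pM radius_le _; rewrite ?mulr_ge0 ?sqr_ge0 //.
    by move: r2_le K1c0_le; lra.
  by move: eps0; lra.
have /ler_normlP[_ +] := err_small x1; have /ler_normlP[_ +] := tform_E_le x1.
by move: hrest hk1 hr3 eps0; lra.
Qed.
End AtDominant.

Lemma argmax_residual x : (exists m, m \notin S) -> sphere_argmax (tform residual) x ->
  exists2 k, k \notin S &
    `|lam k - tform residual x| <= 2 * eps /\ enorm (v k - x) <= 20 * dl k.
Proof.
move=> [m0 m0S] xmax; have [k kS [ak_gt0 akp lam_k]] := dominant m0S xmax.
by exists k => //; exact: spike_recovered.
Qed.

End ResidualMaximizer.

(** * From the noise bound to the induction *)

(** Each summand is at most [(20 * c) ^+ q / n], by the choice of the exponent of
[n] in the bound on [eps]. *)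
Lemma relative_noise_bounds (R : realType) (q n : nat) (lam : 'I_n -> R)
    (n_gt0 : (0 < n)%N) (eps c : R) : (0 < q)%N -> 0 <= eps -> 0 < c ->
  20 * c <= 1 -> (forall l, 0 < lam l) ->
  eps <= c * (min_of n_gt0 lam / (n%:R `^ (q%:R^-1))) ->
  (forall l, eps / lam l <= c) /\
  \sum_l (20 * (eps / lam l)) ^+ q <= 20 * c.
Proof.
move=> q0 eps0 c0 c1 lam0; set N := n%:R `^ _ => heps.
have Nq : N ^+ q = n%:R.
  by rewrite -powR_mulrn ?powR_ge0 // -powRrM mulVf ?pnatr_eq0 -?lt0n // powRr1.
have N_gt0 : 0 < N by rewrite powR_gt0 // ltr0n.
have N_ge1 : 1 <= N by rewrite -(@expr_ge1 _ q) ?(ltW N_gt0) // Nq ler1n.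
have dl_le l : eps / lam l <= c / N.
  rewrite ler_pdivrMr //; apply: le_trans heps _.
  rewrite -mulrA; apply: ler_wpM2l; first exact: ltW.
  rewrite mulrC; apply: ler_wpM2l; first by rewrite invr_ge0 ltW.
  exact: bigmin_le.
split=> [l|].
  by apply: le_trans (dl_le l) _; rewrite ler_pdivrMr // ler_peMr // ltW.
apply: (@le_trans _ _ (\sum_(l < n) (20 * c) ^+ q / n%:R)).
  apply: ler_sum => l _; rewrite -Nq -expr_div_n lerXn2r ?nnegrE //.
  - by rewrite mulr_ge0 // divr_ge0 // ltW.
  - by rewrite divr_ge0 ?mulr_ge0 // ltW.
  - by rewrite -mulrA; apply: ler_wpM2l.
rewrite sumr_const card_ord -[leLHS]mulr_natr divfK ?pnatr_eq0 -?lt0n //.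
have c20 : 0 <= 20 * c by rewrite mulr_ge0 // ltW.
by rewrite -[leRHS]expr1; exact: ler_wiXn2l.
Qed.

Section Matching.
Context {R : realType} {p n : nat}.
Variables (lam lh : 'I_n -> R) (v vh : 'I_n -> 'rV[R]_n) (E : tensor R p n).
Variable U : nat -> tensor R p n.

Let eps := opnorm E.

Definition matched (sigma : 'I_n -> 'I_n) (l : 'I_n) : Prop :=
  `|lam l - lh (sigma l)| <= 2 * eps /\
  enorm (v l - vh (sigma l)) <= 20 * (eps / lam l).

Hypothesis p_ge3 : (2 < p)%N.
Hypothesis p_odd : odd p.
Hypothesis v_onb : orthonormal_basis v.
Hypothesis lam_gt0 : forall l, 0 < lam l.
Hypothesis dl_le : forall l, eps / lam l <= noise_const p.-1.
Hypothesis sum_dl_le :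
  \sum_l (20 * (eps / lam l)) ^+ p.-1 <= 20 * noise_const p.-1.
Hypothesis U0 : U 0 = \sum_l lam l *: tpow p (v l) + E.
Hypothesis U_step : forall i : 'I_n,
  [/\ sphere_argmax (tform (U i)) (vh i), lh i = tform (U i) (vh i) &
      U i.+1 = U i - lh i *: tpow p (vh i)].

(** [S] is the set of the components recovered in the first [j] steps, and
[sigma l] is the step that recovers the component [l]. *)
Lemma matched_prefix j : (j <= n)%N ->
  exists (S : {set 'I_n}) (sigma : 'I_n -> 'I_n),
    [/\ #|S| = j, {in S, forall l, (sigma l < j)%N}, {in S &, injective sigma},
        {in S, forall l, matched sigma l} &
        U j = residual lam (lh \o sigma) v (vh \o sigma) E S].
Proof.
elim: j => [_|j IH jn].
  exists finset.set0, id; split; try by move=> l; rewrite inE.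
    by rewrite cards0.
  by rewrite /residual big_set0 subr0.
have [S [sigma [cardS sigma_lt sigma_inj good UE]]] := IH (ltnW jn).
have := U_step (Ordinal jn); set i := Ordinal jn => -[xmax lhE Unext].
have [m mS] : exists m, m \notin S.
  have /card_gt0P[m] : (0 < #|~: S|)%N by rewrite cardsCs finset.setCK card_ord cardS subn_gt0.
  by rewrite inE; exists m.
rewrite UE in xmax lhE Unext.
have [k kS [hlam hv]] := argmax_residual p_ge3 p_odd v_onb lam_gt0 dl_le sum_dl_le
  good (ex_intro _ m mS) xmax.
pose sigma' l := if l == k then i else sigma l.
have sigma'k : sigma' k = i by rewrite /sigma' eqxx.
have sigma'S l : l \in S -> sigma' l = sigma l.
  by move=> lS; rewrite /sigma' ifN //; apply: contraNneq kS => <-.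
exists (k |: S), sigma'; split.
- by rewrite cardsU1 kS cardS.
- move=> l /finset.setU1P[->|lS]; first by rewrite sigma'k.
  by rewrite sigma'S // ltnW // ltnS sigma_lt.
- move=> l l' /finset.setU1P[->|lS] /finset.setU1P[->|lS'] //; rewrite ?sigma'k ?sigma'S //.
  + by move=> e; have := sigma_lt _ lS'; rewrite -e ltnn.
  + by move=> e; have := sigma_lt _ lS; rewrite e ltnn.
  + exact: sigma_inj.
- move=> l /finset.setU1P[->|lS]; rewrite /matched; first by rewrite sigma'k lhE.
  by rewrite sigma'S //; exact: good.
- rewrite Unext /residual big_setU1 //= sigma'k.
  rewrite [X in _ = _ - (_ + X)](eq_bigr (fun l => lh (sigma l) *: tpow p (vh (sigma l)))).
    by rewrite opprD addrA addrAC.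
  by move=> l lS; rewrite /= sigma'S.
Qed.

Lemma matched_perm :
  exists pi : {perm 'I_n}, forall j, `|lam (pi j) - lh j| <= 2 * eps /\
    enorm (v (pi j) - vh j) <= 20 * (eps / lam (pi j)).
Proof.
have [S [sigma [cardS _ sigma_inj good _]]] := matched_prefix (leqnn n).
have inS l : l \in S.
  have -> : S = [set: 'I_n] by apply/eqP; rewrite eqEcard finset.subsetT cardsT card_ord cardS /=.
  by rewrite inE.
have sinj : injective sigma by move=> l l'; exact: sigma_inj.
exists (perm sinj)^-1%g => j.
have := good _ (inS ((perm sinj)^-1%g j)); rewrite /matched.
by rewrite -(permE sinj) permKV.
Qed.

End Matching.

Theorem theorem3p1 (R : realType) (p : nat) (p_ge3 : (3 <= p)%N)
    (p_odd : odd p) :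
  exists2 c0 : R, 0 < c0 &
    forall (n : nat) (n_gt0 : (0 < n)%N)
      (lambda : 'I_n -> R) (v : 'I_n -> 'rV[R]_n) (E : tensor R p n)
      (lh : 'I_n -> R) (vh : 'I_n -> 'rV[R]_n),
    let T : tensor R p n := \sum_(i < n) lambda i *: tpow p (v i) in
    let That : tensor R p n := T + E in
    let eps : R := opnorm E in
    orthonormal_basis v ->
    (forall i, 0 < lambda i) ->
    symmetric_tensor E ->
    eps <= c0 * (min_of n_gt0 lambda / (n%:R `^ (p.-1%:R^-1))) ->
    SROA_output That lh vh ->
    exists pi : {perm 'I_n}, forall j : 'I_n,
      `|lambda (pi j) - lh j| <= 2 * eps /\
      enorm (v (pi j) - vh j) <= 20 * eps / lambda (pi j).
Proof.
exists (noise_const p.-1); first exact: noise_const_gt0.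
move=> n n_gt0 lam v E lh vh T That eps v_onb lam_gt0 _ eps_le [U [U0 U_step]].
have eps0 : 0 <= eps by apply: opnorm_ge0 => //; exact: leq_trans p_ge3.
have [|dl_le sum_dl_le] := relative_noise_bounds _ eps0 (noise_const_gt0 _)
  (noise_const_le _) lam_gt0 eps_le; first by rewrite -ltnS prednK ltnW // ltnW.
have [pi hpi] := matched_perm p_ge3 p_odd v_onb lam_gt0 dl_le sum_dl_le U0 U_step.
by exists pi => j; rewrite -mulrA.
Qed.
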